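(* Let $S$ be a set of triangles such that $Forb_c(S)$ is a prioritised semi-free amalgamation class with respect to a linearly ordered $\mathcal L'=\{R_1>\dots>R_m\}\subsetneq\mathcal L$, and let $\mathcal M_S$ be its Fraïssé limit. For finite substructures $A,B,C$ of $\mathcal M_S$ define $A\mathrel{\perp\!\!\!\perp}_B C$ if the substructure of $\mathcal M_S$ on $A\cup B\cup C$ equals $AB\otimes_B BC$. Then $\mathrel{\perp\!\!\!\perp}$ is a stationary independence relation on $\mathcal M_S$.
   Context: $\mathcal L$ is a language of binary relation symbols interpreted as symmetric irreflexive relations. A structure is complete if any two distinct elements $a,b$ are related by exactly one relation, denoted $\mathbf r(a,b)$. A triangle is a complete structure on three points, specified by the multiset of its edge relations. $Forb_c(S)$ is the class of finite complete $\mathcal L$-structures embedding no triangle of $S$; throughout $Forb_c(S)$ is an amalgamation class and $\mathcal M_S$ denotes its Fraïssé limit (the countable homogeneous structure with age $Forb_c(S)$). For finite substructures $A,B$ write $AB$ for the substructure on $A\cup B$, and $aB$ for $\{a\}\cup B$. Prioritised amalgamation: for $A,B,C\in Forb_c(S)$ with $B$ a common substructure of $A$ and $C$, $A\otimes_B C$ is the complete structure on the disjoint union of $A$ and $C$ over $B$ extending both $A$ and $C$, in which for $a\in A\setminus B$, $c\in C\setminus B$ one sets $\mathbf r(a,c)=R_i$ where $i$ is the least index such that for no $b\in B$ is the triangle with edges $\mathbf r(a,b),\mathbf r(b,c),R_i$ in $S$ (in particular $\mathbf r(a,c)=R_1$ if $B=\emptyset$). $Forb_c(S)$ is a prioritised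 semi-free amalgamation class (w.r.t. the order) if $A\otimes_B C$ is always defined and lies in $Forb_c(S)$. For a homogeneous structure $\mathcal M$ and finite $B$, the type $tp(a/B)$ of a tuple $a$ over $B$ is identified with the orbit of $a$ under the pointwise stabiliser $G_{(B)}$ of $B$ in $\mathrm{Aut}(\mathcal M)$; an $n$-type over $B$ is such an orbit of $n$-tuples, and its elements are its realisations. A ternary relation $A\mathrel{\perp\!\!\!\perp}_B C$ on finite substructures of $\mathcal M$ is a stationary independence relation if: (Invariance) $A\mathrel{\perp\!\!\!\perp}_B C$ implies $gA\mathrel{\perp\!\!\!\perp}_{gB} gC$ for $g\in\mathrm{Aut}(\mathcal M)$; (Monotonicity) $A\mathrel{\perp\!\!\!\perp}_B CD$ implies $A\mathrel{\perp\!\!\!\perp}_B C$ and $A\mathrel{\perp\!\!\!\perp}_{BC} D$; (Transitivity) $A\mathrel{\perp\!\!\!\perp}_B C$ and $A\mathrel{\perp\!\!\!\perp}_{BC} D$ imply $A\mathrel{\perp\!\!\!\perp}_B D$; (Symmetry) $A\mathrel{\perp\!\!\!\perp}_B C$ implies $C\mathrel{\perp\!\!\!\perp}_B A$; (Existence) every $n$-type $p$ over $B$ and finite $C$, $p$ has a realisation $a$ with $a\mathrel{\perp\!\!\!\perp}_B C$; (Stationarity) if $a,a'$ have the same type over $B$ and $a\mathrel{\perp\!\!\!\perp}_B C$, $a'\mathrel{\perp\!\!\!\perp}_B C$, then $a,a'$ have the same type over $BC$. *)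

(* Defs.v *)
From mathcomp Require Import all_boot.
From mathcomp Require Import finmap multiset.

Set Implicit Arguments.
Unset Strict Implicit.
Unset Printing Implicit Defensive.

Local Open Scope fset_scope.

Record lstructure (L T : Type) := LStructure {
  lrel :> L -> rel T;
  lrel_sym : forall R, symmetric (lrel R);
  lrel_irr : forall R, irreflexive (lrel R) }.

Definition complete (L T : Type) (X : lstructure L T) : Prop :=
  forall a b : T, a <> b -> exists! R : L, X R a b.

Definition embedding (L T U : Type) (X : lstructure L T) (Y : lstructure L U)
    (f : T -> U) : Prop :=
  injective f /\ forall (R : L) (x y : T), Y R (f x) (f y) = X R x y.

Section Induced.
Variables (L : Type) (T : choiceType) (M : lstructure L T) (A : {fset T}).

Definition induced_rel (R : L) : rel A := fun x y => M R (val x) (val y).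

Lemma induced_sym R : symmetric (induced_rel R).
Proof. by move=> x y; apply: lrel_sym. Qed.

Lemma induced_irr R : irreflexive (induced_rel R).
Proof. by move=> x; apply: lrel_irr. Qed.

Definition induced : lstructure L A := LStructure induced_sym induced_irr.

End Induced.

(* A triangle is given by the multiset of its three edge relations. *)
Definition embeds_triangle (L : choiceType) (T : Type) (X : lstructure L T)
    (t : {mset L}%mset) : Prop :=
  exists a b c : T, [/\ a <> b, b <> c & a <> c] /\
  exists P Q R : L, [/\ X P a b, X Q b c, X R a c & t = [mset P; Q; R]%mset].

(* Classes of finite structures; the empty structure is allowed. *)
Definition fin_class (L : Type) := forall T : finType, lstructure L T -> Prop.

Definition forbc (L : choiceType) (S : {mset L}%mset -> Prop) : fin_class L :=
  fun T X => complete X /\ forall t, S t -> ~ embeds_triangle X t.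

Record amalgamation_class (L : Type) (K : fin_class L) : Prop := {
  amalg_hereditary : forall (T U : finType)
    (X : lstructure L T) (Y : lstructure L U) (f : T -> U),
    K U Y -> embedding X Y f -> K T X;
  amalg_joint_embedding : forall (T U : finType)
    (X : lstructure L T) (Y : lstructure L U),
    K T X -> K U Y ->
    exists (V : finType) (Z : lstructure L V) (f : T -> V) (g : U -> V),
      [/\ K V Z, embedding X Z f & embedding Y Z g];
  amalg_amalgamation : forall (T0 T U : finType)
    (X0 : lstructure L T0) (X : lstructure L T) (Y : lstructure L U)
    (f0 : T0 -> T) (g0 : T0 -> U),
    K T0 X0 -> K T X -> K U Y -> embedding X0 X f0 -> embedding X0 Y g0 ->
    exists (V : finType) (Z : lstructure L V) (f : T -> V) (g : U -> V),
      [/\ K V Z, embedding X Z f, embedding Y Z g & f \o f0 =1 g \o g0] }.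

Section PrioritisedAmalgam.
Variables (L : choiceType) (S : {mset L}%mset -> Prop) (m : nat) (Rs : 'I_m -> L).

Section Amalgam.
Variables (TA TB TC TD : Type).
Variables (A : lstructure L TA) (B : lstructure L TB).
Variables (C : lstructure L TC) (D : lstructure L TD).
Variables (iA : TB -> TA) (iC : TB -> TC) (jA : TA -> TD) (jC : TC -> TD).

(* Some b in B makes the triangle with edges r(a,b), r(b,c), R_i lie in S. *)
Definition blocked (a : TA) (c : TC) (i : 'I_m) : Prop :=
  exists (b : TB) (P Q : L),
    [/\ A P a (iA b), C Q (iC b) c & S [mset P; Q; Rs i]%mset].

Definition least_unblocked (a : TA) (c : TC) (i : 'I_m) : Prop :=
  ~ blocked a c i /\ forall j : 'I_m, j < i -> blocked a c j.

(* D, with the maps jA and jC, is the prioritised amalgam of A and C over B,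
   where B is a common substructure of A and C through iA and iC.  As this is
   a relation on D, the amalgam being defined is part of the assertion. *)
Record prio_amalgam : Prop := {
  prio_base_left : embedding B A iA;
  prio_base_right : embedding B C iC;
  prio_complete : complete D;
  prio_left : embedding A D jA;
  prio_right : embedding C D jC;
  prio_over_base : jA \o iA =1 jC \o iC;
  prio_cover : forall d, (exists a, jA a = d) \/ (exists c, jC c = d);
  prio_disjoint : forall a c, jA a = jC c -> exists b, iA b = a /\ iC b = c;
  prio_label : forall a c,
    (forall b, iA b <> a) -> (forall b, iC b <> c) ->
    exists i : 'I_m, least_unblocked a c i /\ D (Rs i) (jA a) (jC c) }.

End Amalgam.

Definition prio_semifree : Prop :=
  forall (TA TB TC : finType)
    (A : lstructure L TA) (B : lstructure L TB) (C : lstructure L TC)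
    (iA : TB -> TA) (iC : TB -> TC),
    forbc S A -> forbc S B -> forbc S C ->
    embedding B A iA -> embedding B C iC ->
    exists (TD : finType) (D : lstructure L TD) (jA : TA -> TD) (jC : TC -> TD),
      prio_amalgam A B C D iA iC jA jC /\ forbc S D.

(* Here AB, B, BC and ABC carry the structures induced by M and all the maps
   are inclusions; in particular AB and BC must meet exactly in B. *)
Definition prio_indep (T : choiceType) (M : lstructure L T)
    (A B C : {fset T}) : Prop :=
  prio_amalgam (induced M (A `|` B)) (induced M B) (induced M (B `|` C))
    (induced M (A `|` B `|` (B `|` C)))
    (fincl (fsubsetUr A B)) (fincl (fsubsetUl B C))
    (fincl (fsubsetUl (A `|` B) (B `|` C)))
    (fincl (fsubsetUr (A `|` B) (B `|` C))).

End PrioritisedAmalgam.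

Section Homogeneous.
Variables (L : Type) (T : choiceType) (M : lstructure L T).

Definition automorphism (g : T -> T) : Prop :=
  bijective g /\ embedding M M g.

Definition homogeneous : Prop :=
  forall (A : {fset T}) (f : A -> T), embedding (induced M A) M f ->
  exists2 g, automorphism g & forall x : A, g (val x) = f x.

Definition in_age : fin_class L :=
  fun U X => exists f : U -> T, embedding X M f.

Definition same_type (B : {fset T}) (n : nat) (a a' : n.-tuple T) : Prop :=
  exists g, [/\ automorphism g, {in B, forall b, g b = b} &
                a' = map_tuple g a].

(* An n-type over B is an orbit of n-tuples under the pointwise stabiliser
   of B. *)
Definition ntype (B : {fset T}) (n : nat) (p : n.-tuple T -> Prop) : Prop :=
  exists a, forall a', p a' <-> same_type B a a'.

Definition points (n : nat) (a : n.-tuple T) : {fset T} :=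
  [fset x in tval a].

Record stationary_independence
    (ind : {fset T} -> {fset T} -> {fset T} -> Prop) : Prop := {
  sir_invariance : forall A B C g, automorphism g ->
    ind A B C -> ind (g @` A) (g @` B) (g @` C);
  sir_monotonicity : forall A B C D,
    ind A B (C `|` D) -> ind A B C /\ ind A (B `|` C) D;
  sir_transitivity : forall A B C D,
    ind A B C -> ind A (B `|` C) D -> ind A B D;
  sir_symmetry : forall A B C, ind A B C -> ind C B A;
  sir_existence : forall n (B : {fset T}) (p : n.-tuple T -> Prop),
    ntype B p -> forall C, exists2 a, p a & ind (points a) B C;
  sir_stationarity : forall n (B C : {fset T}) (a a' : n.-tuple T),
    same_type B a a' -> ind (points a) B C -> ind (points a') B C ->
    same_type (B `|` C) a a' }.

End Homogeneous.

Definition fraisse_limit (L : Type) (K : fin_class L) (T : countType)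
    (M : lstructure L T) : Prop :=
  homogeneous M /\ forall (U : finType) (X : lstructure L U),
    K U X <-> in_age M X.

(* Main.v *)
Require Import Defs.
From mathcomp Require Import all_boot.
From mathcomp Require Import finmap multiset.

(** Inside a complete structure omitting [S], [A] is independent from [C] over
    [B] when [A] and [C] meet inside [B] and every edge between [A \ B] and
    [C \ B] carries the least label not blocked by [B].  Enlarging [B] can only
    block more labels, never the one actually realised, which gives
    monotonicity.  For transitivity, compare [a] in [A] and [d] in [D] with
    the abstract amalgam of [AB] and [BCD] over [B]: as it omits [S], its label
    between [a] and [d] is not blocked by [C] either, so the least labels over
    [B] and over [BC] agree.  Existence embeds the abstract amalgam in the limit
    and moves it back over [BC] by homogeneity; stationarity glues an
    automorphism over [B] with the identity of [BC]. *)

Set Implicit Arguments.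
Unset Strict Implicit.
Unset Printing Implicit Defensive.

Local Open Scope fset_scope.

(** * Generalities on edge labels, embeddings and automorphisms *)

Lemma mset3C (L : choiceType) (P Q R : L) :
  [mset P; Q; R]%mset = [mset Q; P; R]%mset.
Proof. by rewrite [([mset P; Q])%mset]msetDC. Qed.

Lemma complete_eq (L T : Type) (X : lstructure L T) (P Q : L) (a b : T) :
  complete X -> X P a b -> X Q a b -> P = Q.
Proof.
move=> cX XP XQ.
have neq_ab : a <> b by move=> eq_ab; rewrite eq_ab lrel_irr in XP.
by have [R [_ uR]] := cX _ _ neq_ab; rewrite -(uR P XP) (uR Q XQ).
Qed.

Lemma embedding_comp (L T U V : Type) (X : lstructure L T) (Y : lstructure L U)
    (Z : lstructure L V) (f : T -> U) (g : U -> V) :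
  embedding X Y f -> embedding Y Z g -> embedding X Z (g \o f).
Proof.
by move=> [fI Ef] [gI Eg]; split=> [|R x y /=]; [apply: inj_comp | rewrite Eg Ef].
Qed.

Lemma embedding_incl (L : Type) (T : choiceType) (M : lstructure L T)
    (A B : {fset T}) (sAB : A `<=` B) :
  embedding (induced M A) (induced M B) (fincl sAB).
Proof. by split=> // x y /(congr1 val) /= /val_inj. Qed.

Lemma embedding_val (L : Type) (T : choiceType) (M : lstructure L T)
    (A : {fset T}) : embedding (induced M A) M val.
Proof. by split=> //; apply: val_inj. Qed.

Lemma automorphism_inv (L : Type) (T : choiceType) (M : lstructure L T)
    (g : T -> T) : automorphism M g ->
  exists h, [/\ automorphism M h, cancel g h & cancel h g].
Proof.
move=> [[h gK hK] [_ Eg]]; exists h; split=> //; split; first by exists g.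
by split=> [|R x y]; [apply: can_inj hK | rewrite -{2}(hK x) -{2}(hK y) Eg].
Qed.

Section Limit.
Variables (L : choiceType) (S : {mset L}%mset -> Prop) (m : nat) (Rs : 'I_m -> L).

(** * Blocked and least labels inside one ambient structure *)

Section Structure.
Variables (T : choiceType) (M : lstructure L T).

(** Restates [blocked] with points of the ambient structure in place of inclusion maps, so that
    different bases can be compared for the same pair. *)
Definition blocked_over (B : {fset T}) (a c : T) (i : 'I_m) : Prop :=
  exists (b : T) (P Q : L),
    [/\ b \in B, M P a b, M Q b c & S [mset P; Q; Rs i]%mset].

Definition least_over (B : {fset T}) (a c : T) (i : 'I_m) : Prop :=
  ~ blocked_over B a c i /\ forall j : 'I_m, j < i -> blocked_over B a c j.

Lemma least_over_uniq B a c i j :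
  least_over B a c i -> least_over B a c j -> i = j.
Proof.
move=> [ni li] [nj lj]; apply: val_inj.
by case: (ltngtP (val i) (val j)) => // [/lj/ni | /li/nj].
Qed.

Lemma least_over_transfer (B B' : {fset T}) (a c a' c' : T) i :
  (forall j, blocked_over B a c j <-> blocked_over B' a' c' j) ->
  least_over B a c i -> least_over B' a' c' i.
Proof. by move=> E [ni li]; split=> [/E/ni | j /li/E]. Qed.

(** Triangles are multisets and relations are symmetric, so the two edges at [b] may be
    exchanged. *)
Lemma blocked_overC B a c i : blocked_over B a c i <-> blocked_over B c a i.
Proof.
by split=> -[b [P [Q [bB MP MQ SPQ]]]]; exists b, Q, P; split;
  rewrite // 1?lrel_sym // mset3C.
Qed.

Lemma blocked_overS (B B' : {fset T}) a c i :
  B `<=` B' -> blocked_over B a c i -> blocked_over B' a c i.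
Proof.
move=> /fsubsetP sBB' [b [P [Q [bB MP MQ SPQ]]]].
by exists b, P, Q; split=> //; apply: sBB'.
Qed.

Lemma blocked_over_aut (g : T -> T) B a c i : automorphism M g ->
  blocked_over (g @` B) (g a) (g c) i <-> blocked_over B a c i.
Proof.
move=> [_ [_ Eg]]; split=> [[_ [P [Q [/imfsetP[b /= bB ->]]]]]|[b [P [Q [bB]]]]].
  by rewrite !Eg => MP MQ SPQ; exists b, P, Q.
move=> MP MQ SPQ; exists (g b), P, Q; split; rewrite ?Eg //.
exact: in_imfset.
Qed.

(** * Independence as a condition on points and labels *)

Definition least_indep (A B C : {fset T}) : Prop :=
  (forall x, x \in A -> x \in C -> x \in B) /\
  forall a c, a \in A -> c \in C -> a \notin B -> c \notin B ->
    exists2 i, least_over B a c i & M (Rs i) a c.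

Lemma blocked_incl (A B C : {fset T}) (sBA : B `<=` A) (sBC : B `<=` C)
    (a : A) (c : C) i :
  blocked S Rs (induced M A) (induced M C) (fincl sBA) (fincl sBC) a c i <->
  blocked_over B (val a) (val c) i.
Proof.
split=> [[b [P [Q [MP MQ SPQ]]]]|[b [P [Q [bB MP MQ SPQ]]]]].
  by exists (val b), P, Q; split=> //; apply: fsvalP.
by exists [` bB], P, Q.
Qed.

Lemma least_incl (A B C : {fset T}) (sBA : B `<=` A) (sBC : B `<=` C)
    (a : A) (c : C) i :
  least_unblocked S Rs (induced M A) (induced M C) (fincl sBA) (fincl sBC) a c i
  <-> least_over B (val a) (val c) i.
Proof.
by split=> -[ni li]; split=> [/blocked_incl/ni | j /li/blocked_incl].
Qed.

Lemma notin_incl (A B : {fset T}) (sBA : B `<=` A) (a : A) :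
  val a \notin B <-> forall b, fincl sBA b <> a.
Proof.
split=> [aB b ba | na]; first by rewrite -ba (fsvalP b) in aB.
by apply/negP=> aB; apply: (na [` aB]); apply: val_inj.
Qed.

(** When all the maps are inclusions into a complete structure, only [prio_disjoint] and
    [prio_label] carry content; the other fields hold automatically. *)
Lemma prio_indepP (A B C : {fset T}) : complete M ->
  prio_indep S Rs M A B C <-> least_indep A B C.
Proof.
move=> cM; split=> [[_ _ _ _ _ _ _ dis lab]|[dis lab]].
  split=> [x xA xC | a c aA cC aB cB].
    have xAB : x \in A `|` B by rewrite inE xA.
    have xBC : x \in B `|` C by rewrite inE xC orbT.
    have [|b [/(congr1 val)/= bx _]] := dis [` xAB] [` xBC]; first exact: val_inj.
    by rewrite -bx; apply: fsvalP.
  have aAB : a \in A `|` B by rewrite inE aA.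
  have cBC : c \in B `|` C by rewrite inE cC orbT.
  have [||i [/least_incl li Mi]] := lab [` aAB] [` cBC]; last by exists i.
    exact/notin_incl.
  exact/notin_incl.
split.
- exact: embedding_incl.
- exact: embedding_incl.
- move=> x y neq_xy; apply: (cM (val x) (val y)) => /val_inj; exact: neq_xy.
- exact: embedding_incl.
- exact: embedding_incl.
- by move=> b; apply: val_inj.
- move=> d; have := fsvalP d; rewrite inE => /orP[dAB | dBC].
    by left; exists [` dAB]; apply: val_inj.
  by right; exists [` dBC]; apply: val_inj.
- move=> a c /(congr1 val)/= ac.
  have aB : val a \in B.
    have := fsvalP a; have := fsvalP c; rewrite -ac !inE.
    by case/orP=> [//|aC] /orP[aA|//]; apply: dis.
  by exists [` aB]; split; apply: val_inj.
- move=> a c /notin_incl aB /notin_incl cB.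
  have aA : val a \in A by have := fsvalP a; rewrite inE (negPf aB) orbF.
  have cC : val c \in C by have := fsvalP c; rewrite inE (negPf cB).
  by have [i li Mi] := lab _ _ aA cC aB cB; exists i; split=> //; apply/least_incl.
Qed.

Lemma least_indep_sym A B C : least_indep A B C -> least_indep C B A.
Proof.
move=> [dis lab]; split=> [x xC xA|c a cC aA cB aB]; first exact: dis.
have [i li Mi] := lab a c aA cC aB cB; exists i; last by rewrite lrel_sym.
by apply: least_over_transfer li => j; apply: blocked_overC.
Qed.

Lemma least_indep_aut (g : T -> T) A B C : automorphism M g ->
  least_indep A B C -> least_indep (g @` A) (g @` B) (g @` C).
Proof.
move=> autg; have [_ [gI Eg]] := autg.
move=> [dis lab]; split=> [_ /imfsetP[x /= xA ->]|].
  by rewrite !(mem_imfset _ _ gI) /=; apply: dis.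
move=> _ _ /imfsetP[a /= aA ->] /imfsetP[c /= cC ->].
rewrite !(mem_imfset _ _ gI) /= => aB cB.
have [i li Mi] := lab a c aA cC aB cB; exists i; last by rewrite Eg.
apply: least_over_transfer li => j; apply: iff_sym; exact: blocked_over_aut.
Qed.

Lemma least_indep_mono A B C D :
  (forall t, S t -> ~ embeds_triangle M t) ->
  least_indep A B (C `|` D) -> least_indep A B C /\ least_indep A (B `|` C) D.
Proof.
move=> omit [dis lab]; split; split=> [x xA xC | a c aA cC].
- by apply: dis; rewrite // inE xC.
- by apply: lab; rewrite // inE cC.
- by rewrite inE dis // inE xC orbT.
rewrite !inE !negb_or => /andP[aB aC] /andP[cB cC'].
have [|i [ni li] Mi] := lab a c aA _ aB cB; first by rewrite inE cC orbT.
exists i => //; split=> [[b [P [Q [bBC MP MQ SPQ]]]]|j /li].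
  (* A point [b] blocking the realised label would form with [a] and [c] a triangle of [S] in
     [M]. *)
  apply: (omit _ SPQ); exists a, b, c; split; last by exists P, Q, (Rs i).
  split=> [E|E|E]; [move: MP|move: MQ|move: Mi]; by rewrite E lrel_irr.
by apply: blocked_overS; apply: fsubsetUl.
Qed.

(** * Transitivity through the abstract amalgam *)

Section Semifree.
Hypothesis M_forbc : forall A : {fset T}, forbc S (induced M A).
Hypothesis semifree : prio_semifree S Rs.

Lemma prio_amalgam_exists (A B C : {fset T}) (sBA : B `<=` A) (sBC : B `<=` C) :
  exists (V : finType) (D : lstructure L V) (jA : A -> V) (jC : C -> V),
  prio_amalgam S Rs (induced M A) (induced M B) (induced M C) D
    (fincl sBA) (fincl sBC) jA jC /\ forbc S D.
Proof. by apply: semifree => //; apply: embedding_incl. Qed.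

(* In the abstract amalgam of [aB] and [BCd] over [B], the pairs [a, c] keep
   their labels from [M], so the label it chooses for [a, d] is compatible
   with all of [BC]. *)
Lemma least_over_indep A B C a d i :
  least_indep A B C -> a \in A -> a \notin B -> d \notin B ->
  d \notin C -> least_over (B `|` C) a d i -> least_over B a d i.
Proof.
move=> [dis lab] aA aB dB dC li.
have sBA : B `<=` A `|` B by apply: fsubsetUr.
have sBC : B `<=` B `|` C `|` [fset d].
  by rewrite -fsetUA; apply: fsubsetUl.
have [V [D [jA [jC [am [cD omit]]]]]] := prio_amalgam_exists sBA sBC.
have [[_ Eb] [_ Eb'] _ [jAI EA] [jCI EC] jAC _ jdis jlab] := am.
have aAB : a \in A `|` B by rewrite inE aA.
have dBC : d \in B `|` C `|` [fset d] by rewrite !inE eqxx !orbT.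
have [||k [/least_incl/= lk Dk]] := jlab [` aAB] [` dBC].
- exact/notin_incl.
- exact/notin_incl.
(* [k] is least over [B]. If it is also least over the larger base, uniqueness there forces it to be
   [i]. *)
suff lk' : least_over (B `|` C) a d k by rewrite (least_over_uniq li lk').
have [nk ltk] := lk; split=> [|j /ltk]; last first.
  by apply: blocked_overS; apply: fsubsetUl.
move=> [e [P [Q [eBC MP MQ SPQ]]]].
have [eB | eB] := boolP (e \in B); first by apply: nk; exists e, P, Q.
have eC : e \in C by move: eBC; rewrite inE (negPf eB).
have eBCd : e \in B `|` C `|` [fset d] by rewrite inE eBC.
(* The label of [a] and [e] is the least one over [B] both in [M], by independence from [C], and in
   [D], by construction; hence [P] survives in [D]. *)
have [l ll Ml] := lab a e aA eC aB eB.
have [||l' [/least_incl/= ll' Dl]] := jlab [` aAB] [` eBCd].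
- exact/notin_incl.
- exact/notin_incl.
(* Completeness is assumed here for finite induced substructures, so it is applied to the pair. *)
have Pl : P = Rs l.
  have [cA _] := M_forbc [fset a; e].
  have aP : a \in [fset a; e] by rewrite !inE eqxx.
  have eP : e \in [fset a; e] by rewrite !inE eqxx orbT.
  exact: (@complete_eq _ _ _ P (Rs l) [` aP] [` eP] cA).
have DP : D P (jA [` aAB]) (jC [` eBCd]).
  by rewrite Pl (least_over_uniq ll ll').
have DQ : D Q (jC [` eBCd]) (jC [` dBC]) by rewrite EC.
(* The images of [a], [e] and [d] span in [D] the triangle with edges [P], [Q], [Rs k], which is in
   [S]. *)
apply: (omit _ SPQ); exists (jA [` aAB]), (jC [` eBCd]), (jC [` dBC]).
split; last by exists P, Q, (Rs k).
by split=> E; [move: DP|move: DQ|move: Dk]; rewrite E lrel_irr.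
Qed.

(** Pairs with [d] in [C] are settled by the first independence; for the others [least_over_indep]
    brings the least label down to the base [B]. *)
Lemma least_indep_trans A B C D :
  least_indep A B C -> least_indep A (B `|` C) D -> least_indep A B D.
Proof.
move=> iABC [dis lab]; have [dis0 lab0] := iABC.
split=> [x xA xD | a d aA dD aB dB].
  by have := dis x xA xD; rewrite inE => /orP[//|]; apply: dis0.
have [dC | dC] := boolP (d \in C); first exact: lab0.
have aC : a \notin C by apply: contra aB; apply: dis0.
have [|| i li Mi] := lab a d aA dD; rewrite ?inE ?negb_or ?aB ?aC ?dB ?dC //.
by exists i => //; apply: (least_over_indep iABC).
Qed.

End Semifree.
End Structure.

(** * Existence and stationarity in the limit, by homogeneity *)

Section Fraisse.
Variables (T : countType) (M : lstructure L T).
Hypothesis M_limit : fraisse_limit (forbc S) M.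

Lemma limit_induced (A : {fset T}) : forbc S (induced M A).
Proof. by case: M_limit => _ ->; exists val; apply: embedding_val. Qed.

Lemma limit_complete : complete M.
Proof.
move=> a b neq_ab; have [cA _] := limit_induced [fset a; b].
have aA : a \in [fset a; b] by rewrite !inE eqxx.
have bA : b \in [fset a; b] by rewrite !inE eqxx orbT.
by apply: (cA [` aA] [` bA]) => /(congr1 val).
Qed.

Lemma limit_omits t : S t -> ~ embeds_triangle M t.
Proof.
move=> St [a [b [c [[ab bc ac] E]]]].
have aA : a \in [fset a; b; c] by rewrite !inE eqxx.
have bA : b \in [fset a; b; c] by rewrite !inE eqxx orbT.
have cA : c \in [fset a; b; c] by rewrite !inE eqxx !orbT.
have [_ /(_ t St)] := limit_induced [fset a; b; c]; apply.
exists [` aA], [` bA], [` cA]; split=> //.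
by split=> /(congr1 val).
Qed.

(** Phrased with an automorphism because the realisations of a type over [B] are the images of one
    of them under the pointwise stabiliser of [B]. *)
Lemma least_indep_exists (A B C : {fset T}) : prio_semifree S Rs ->
  exists h, [/\ automorphism M h, {in B, forall b, h b = b}
    & least_indep M (h @` A) B C].
Proof.
move=> semifree; have [homM ageM] := M_limit.
have sBA : B `<=` A `|` B by apply: fsubsetUr.
have sBC : B `<=` B `|` C by apply: fsubsetUl.
have [V [D [jA [jC [am fD]]]]] :=
  prio_amalgam_exists limit_induced semifree sBA sBC.
have [_ _ _ eA eC jAC _ jdis jlab] := am.
have [f ef] : in_age M D by apply/ageM.
(* [g] carries the original [BC] to its copy in the embedded amalgam. Its inverse [g'] moves that
   copy back, and [h] extends the resulting placement of [AB]. *)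
have [g autg Eg] := homM _ _ (embedding_comp eC ef).
have [g' [autg' gK g'K]] := automorphism_inv autg.
have [h auth Eh] := homM _ _ (embedding_comp (embedding_comp eA ef) autg'.2).
have fjC (c : B `|` C) : g' (f (jC c)) = val c by rewrite -[f _]Eg gK.
have hB : {in B, forall b, h b = b}.
  move=> b bB; have /= -> := Eh (fincl sBA [` bB]).
  by have /= -> := jAC [` bB]; rewrite fjC.
have [_ [hI Ehh]] := auth; have [_ [g'I Eg']] := autg'; have [fI Ef] := ef.
exists h; split=> //; split=> [_ /imfsetP[a /= aA ->] hC|].
  have aAB : a \in A `|` B by rewrite inE aA.
  have hBC : h a \in B `|` C by rewrite inE hC orbT.
  (* If [h a] is in [BC], then in [D] the image of [a] under [jA] equals that of [h a] under [jC],
     so [h a] comes from the base. *)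
  have [|b [_ /(congr1 val)/= <-]] := jdis [` aAB] [` hBC]; last exact: fsvalP.
  by apply: fI; apply: g'I; rewrite fjC -[LHS]Eh.
move=> _ c /imfsetP[a /= aA ->] cC haB cB.
have aB : a \notin B by apply: contra haB => aB; rewrite hB.
have aAB : a \in A `|` B by rewrite inE aA.
have cBC : c \in B `|` C by rewrite inE cC orbT.
have [||i [/least_incl/= li Di]] := jlab [` aAB] [` cBC].
- exact/notin_incl.
- exact/notin_incl.
exists i; last first.
  have /= -> := Eh [` aAB].
  by rewrite -[c]/(val [` cBC]) -fjC Eg' Ef.
(* As [h] fixes [B] pointwise, [a] and [h a] have the same labels to [B], hence the same blocked
   labels towards [c]. *)
apply: least_over_transfer li => j.
split=> -[b [P [Q [bB MP MQ SPQ]]]]; exists b, P, Q; split=> //.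
  by rewrite -(hB b bB) Ehh.
by rewrite -Ehh (hB b bB).
Qed.

(* Glues [g] on [AB] with the identity on [BC]. *)
Lemma least_indep_stationary (A B C : {fset T}) (g : T -> T) :
  automorphism M g -> {in B, forall b, g b = b} ->
  least_indep M A B C -> least_indep M (g @` A) B C ->
  exists h, [/\ automorphism M h, {in B `|` C, forall b, h b = b}
    & {in A, h =1 g}].
Proof.
move=> autg gB [dis lab] [dis' lab']; have [_ [gI Eg]] := autg.
have [homM _] := M_limit.
(* The two pieces are compatible: [A] and [C] meet inside [B], where [g] is the identity. *)
pose f x := if x \in A then g x else x.
have fA : {in A, f =1 g} by move=> x xA; rewrite /f xA.
have fAB x : x \in A `|` B -> f x = g x.
  by rewrite /f inE; case: ifP => //= _ /gB.
have fBC x : x \in B `|` C -> f x = x.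
  rewrite /f inE; case: ifP => // xA /orP[/gB//|xC].
  by apply: gB; apply: dis.
have cross a c : a \in A -> a \notin B -> c \in C -> c \notin B ->
    g a <> c /\ forall R, M R (g a) c = M R a c.
  move=> aA aB cC cB.
  have gaA : g a \in g @` A by apply: in_imfset.
  have gaB : g a \notin B.
    (* If [g a] were in [B], then [g (g a) = g a], and injectivity would give [g a = a]. *)
    by apply: contra aB => gaB; rewrite -(gI _ _ (gB _ gaB)).
  split=> [E|R].
    by move/negP: gaB; apply; apply: dis'; rewrite ?E // -E.
  have [i li Mi] := lab a c aA cC aB cB.
  have [k lk Mk] := lab' _ c gaA cC gaB cB.
  (* Since [g] fixes [B], the pairs [a], [c] and [g a], [c] have the same blocked labels, and both
     realise the least unblocked one. *)
  have ik : i = k.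
    apply: least_over_uniq lk; apply: least_over_transfer li => j.
    split=> -[b [P [Q [bB MP MQ SPQ]]]]; exists b, P, Q; split=> //.
      by rewrite -(gB b bB) Eg.
    by rewrite -Eg (gB b bB).
  apply/idP/idP => MR.
    by rewrite (complete_eq limit_complete MR Mk) -ik.
  by rewrite (complete_eq limit_complete MR Mi) ik.
have split_dom x : x \in A `|` (B `|` C) ->
    [\/ x \in B, (x \in A) && (x \notin B) | (x \in C) && (x \notin B)].
  rewrite !inE; have [xB|xB] := boolP (x \in B); first by constructor 1.
  by case/orP=> /= xX; [constructor 2|constructor 3]; rewrite xX.
have ef : embedding (induced M (A `|` (B `|` C))) M (f \o val).
  have inAB z : z \in B -> z \in A `|` B by rewrite inE orbC => ->.
  have inBC z : z \in B -> z \in B `|` C by rewrite inE => ->.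
  have inA z : z \in A -> z \in A `|` B by rewrite inE => ->.
  have inC z : z \in C -> z \in B `|` C by rewrite inE orbC => ->.
  have fAC u v : u \in A -> u \notin B -> v \in C -> v \notin B ->
      f u <> f v /\ forall R, M R (f u) (f v) = M R u v.
    by move=> uA uB vC vB; rewrite (fA u) // (fBC v) ?inC //; apply: cross.
  have f_emb u v : u \in A `|` (B `|` C) -> v \in A `|` (B `|` C) ->
      (f u = f v -> u = v) /\ forall R, M R (f u) (f v) = M R u v.
    have same_AB : u \in A `|` B -> v \in A `|` B ->
        (f u = f v -> u = v) /\ forall R, M R (f u) (f v) = M R u v.
      by move=> /fAB-> /fAB->; split=> [/gI|R].
    have same_BC : u \in B `|` C -> v \in B `|` C ->
        (f u = f v -> u = v) /\ forall R, M R (f u) (f v) = M R u v.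
      by move=> /fBC-> /fBC->.
    (* Of the nine cases, seven lie inside [AB] or inside [BC]; the two cross cases are mirror
       images of each other. *)
    case/split_dom=> [uB|/andP[uA uB]|/andP[uC uB]];
      case/split_dom=> [vB|/andP[vA vB]|/andP[vC vB]];
      try by [apply: same_AB; auto | apply: same_BC; auto].
      by have [neq Euv] := fAC u v uA uB vC vB; split.
    have [neq Evu] := fAC v u vA vB uC uB.
    by split=> [/esym//|R]; rewrite lrel_sym Evu lrel_sym.
  split=> [x y /= fxy|R x y]; last exact: (f_emb _ _ (fsvalP x) (fsvalP y)).2.
  exact/val_inj/(f_emb _ _ (fsvalP x) (fsvalP y)).1.
have [h auth Eh] := homM _ _ ef.
exists h; split=> // [b bBC | a aA].
  have bABC : b \in A `|` (B `|` C) by rewrite inE bBC orbT.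
  by have /= -> := Eh [` bABC]; apply: fBC.
have aABC : a \in A `|` (B `|` C) by rewrite inE aA.
by have /= -> := Eh [` aABC]; apply: fA.
Qed.

Lemma points_map n (a : n.-tuple T) (g : T -> T) :
  points (map_tuple g a) = g @` points a.
Proof.
apply/fsetP=> x; apply/idP/imfsetP => [|[y /= ya ->]].
  by rewrite inE => /mapP[y ya ->]; exists y; rewrite //= inE.
by move: ya; rewrite !inE; apply: map_f.
Qed.

End Fraisse.
End Limit.

Theorem theorem3p3 (L : choiceType) (S : {mset L}%mset -> Prop)
    (S_triangles : forall t : {mset L}%mset, S t -> size t = 3)
    (forb_amalgamation : amalgamation_class (forbc S))
    (m : nat) (Rs : 'I_m -> L)
    (Rs_inj : injective Rs) (Rs_proper : exists R : L, forall i, Rs i <> R)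
    (forb_semifree : prio_semifree S Rs)
    (T : countType) (M : lstructure L T)
    (M_limit : fraisse_limit (forbc S) M) :
  stationary_independence M (prio_indep S Rs M).
Proof.
have cM := limit_complete M_limit.
split.
- move=> A B C g autg /(prio_indepP _ _ _ _ _ cM) iABC.
  exact/prio_indepP/least_indep_aut.
- move=> A B C D /(prio_indepP _ _ _ _ _ cM).
  case/(least_indep_mono (limit_omits M_limit)).
  by split; apply/prio_indepP.
- move=> A B C D /(prio_indepP _ _ _ _ _ cM) iABC /(prio_indepP _ _ _ _ _ cM) iAD.
  apply/prio_indepP => //.
  exact: least_indep_trans (limit_induced M_limit) forb_semifree _ _ _ _ iABC iAD.
- move=> A B C /(prio_indepP _ _ _ _ _ cM) iABC.
  exact/prio_indepP/least_indep_sym.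
- move=> n B p [a Ep] C.
  (* [a] is a representative of the orbit [p], so its image under [h] realises [p] as well. *)
  have [h [auth hB ih]] := least_indep_exists M_limit (points a) B C forb_semifree.
  exists (map_tuple h a); first by apply/Ep; exists h.
  by apply/prio_indepP; rewrite // points_map.
move=> n B C a a' [g [autg gB ->]] /(prio_indepP _ _ _ _ _ cM) ia.
rewrite points_map => /(prio_indepP _ _ _ _ _ cM) ia'.
have [h [auth hBC hg]] := least_indep_stationary M_limit autg gB ia ia'.
exists h; split=> //; apply: val_inj => /=.
by apply/eq_in_map => x xa; rewrite hg // inE.
Qed.
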